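(* Let $W=W^{p,q}([m])$ be the finite-dimensional complex vector space with the operators $E_{11},E_{22},E_{33},L,E_{12},E_{21},E_{23},E_{32}$ given explicitly in the context, for the highest weight $[m]=[m_{13},m_{23},m_{33}]$. Then this representation is irreducible (in which case it is called typical) if and only if $$[l_{13}+l_{33}+3]\,[l_{23}+l_{33}+3]\neq 0 .$$
   Context: Parameters. $p,q$ are nonzero complex numbers, generic: none of $p$, $q$, $pq$ is a root of unity. Logarithms $\log p,\log q$ are fixed and $p^x=e^{x\log p}$, $q^x=e^{x\log q}$, $(p/q)^x=p^xq^{-x}$, $(q/p)^x=q^xp^{-x}$ for $x\in\mathbb C$. For $x\in\mathbb C$ put $[x]=\dfrac{q^{x}-p^{-x}}{q-p^{-1}}$. For every integer $n\ge 0$ a square root $[n]^{1/2}$ is fixed, and square roots of products and quotients of such numbers are understood multiplicatively. Weights. $m_{13},m_{23},m_{33}\in\mathbb C$ with $m_{13}-m_{23}\in\mathbb Z_{\ge 0}$. Put $l=\tfrac12(m_{13}-m_{23})$, $l_{13}=m_{13}-1$, $l_{23}=m_{23}-2$, $l_{33}=m_{33}-1$. The numbers $a_1,a_2,a_3$ are arbitrary fixed nonzero complex parameters. The space. For $k=0,1,2,3$ let $(m_{12},m_{22},m_{31})$ be, respectively, $(m_{13},\,m_{23},\,m_{33})$; $(m_{13},\,m_{23}-1,\,m_{33}+1)$; $(m_{13}-1,\,m_{23},\,m_{33}+1)$; $(m_{13}-1,\,m_{23}-1,\,m_{33}+2)$. Let $V_k$ be the vector space with basis the symbols $(m)_k$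 indexed by all $m_{11}$ with $m_{12}-m_{11}\in\mathbb Z_{\ge0}$ and $m_{11}-m_{22}\in\mathbb Z_{\ge0}$ (so $V_2=0$ if $m_{13}=m_{23}$). Put $W=V_0\oplus V_1\oplus V_2\oplus V_3$, write $(m)=(m)_0$, and $l_{11}=m_{11}-1$, $l_{12}=m_{12}-1$, $l_{22}=m_{22}-2$. The vector $(m)_k^{\pm 11}$ is obtained from $(m)_k$ by replacing $m_{11}$ with $m_{11}\pm1$. A term whose symbol is not one of the basis vectors is read as $0$. Action of the even generators of $U_{p,q}[gl(2/1)]$ (for each $k$, with the $m_{12},m_{22},m_{31}$ of $V_k$): $E_{11}(m)_k=(l_{11}+1)(m)_k$; $E_{22}(m)_k=(l_{12}+l_{22}-l_{11}+2)(m)_k$; $E_{33}(m)_k=m_{31}(m)_k$; $L(m)_k=\tfrac12(l_{12}-l_{22}-1)(m)_k$; $E_{12}(m)_k=([l_{12}-l_{11}][l_{11}-l_{22}])^{1/2}(m)_k^{+11}$; $E_{21}(m)_k=([l_{12}-l_{11}+1][l_{11}-l_{22}-1])^{1/2}(m)_k^{-11}$. Action of the odd generators (all symbols in a given formula have the same $m_{11}$): $E_{23}(m)=0$; $E_{23}(m)_1=a_1(p/q)^{l_{23}+l_{33}+3}\left(\frac{[l_{11}-l_{23}]}{[2l+1]}\right)^{1/2}[l_{23}+l_{33}+3]\,(m)$; $E_{23}(m)_2=a_2(p/q)^{l_{23}+l_{33}+4}\left(\frac{[l_{13}-l_{11}]}{[2l]}\right)^{1/2}[l_{13}+l_{33}+3]\,(m)$;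 $E_{23}(m)_3=a_3(p/q)^{l_{13}+l_{23}+l_{33}-l_{11}+2}\Big\{\frac{1}{a_1q}\left(\frac{[l_{13}-l_{11}]}{[2l+1]}\right)^{1/2}[l_{13}+l_{33}+3]\,(m)_1-\frac{1}{a_2p}([l_{11}-l_{23}][2l])^{1/2}\frac{[l_{23}+l_{33}+3]}{[2l+1]}\,(m)_2\Big\}$; $E_{32}(m)=\frac1{a_1}\left(\frac{[l_{11}-l_{23}]}{[2l+1]}\right)^{1/2}(m)_1+\frac1{a_2}(p/q)^{l_{13}-l_{11}-1}\frac{([l_{13}-l_{11}][2l])^{1/2}}{[2l+1]}\,(m)_2$; $E_{32}(m)_1=\frac{a_1}{a_3}\,p\left(\frac{[l_{13}-l_{11}]}{[2l+1]}\right)^{1/2}(m)_3$; $E_{32}(m)_2=-\frac{a_2}{a_3}\,p\,(q/p)^{l_{13}-l_{11}-1}\left(\frac{[l_{11}-l_{23}]}{[2l]}\right)^{1/2}(m)_3$; $E_{32}(m)_3=0$. A subspace of $W$ is invariant if it is stable under all eight kinds of operators $E_{11},E_{22},E_{33},L,E_{12},E_{21},E_{23},E_{32}$; a representation is irreducible if it is nonzero and has no invariant subspaces other than $0$ and itself. *)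

(* Defs.v *)
(* The complex numbers are R[i] for a realType R. *)
From HB Require Import structures.
From mathcomp Require Import all_boot all_order all_algebra complex.
From mathcomp Require Import reals sequences exp trigo ring.

Set Implicit Arguments.
Unset Strict Implicit.
Unset Printing Implicit Defensive.

Import Order.TTheory GRing.Theory Num.Theory.

Local Open Scope ring_scope.

Definition expC (R : realType) (z : R[i]) : R[i] :=
  Complex (expR (complex.Re z) * cos (complex.Im z))
          (expR (complex.Re z) * sin (complex.Im z)).

(* x-th power of the number whose chosen logarithm is lz *)
Definition powC (R : realType) (lz x : R[i]) : R[i] := expC (x * lz).

Definition is_root_of_unity (F : fieldType) (z : F) : Prop :=
  exists2 k : nat, (0 < k)%N & k.-unity_root z.

(* [x] = (q^x - p^(-x)) / (q - p^(-1)), with lp = log p and lq = log q *)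
Definition qnum (R : realType) (p q lp lq x : R[i]) : R[i] :=
  (powC lq x - powC lp (- x)) / (q - p^-1).

Section Subrepresentations.
Variables (F : fieldType) (V : vectType F).

Definition invariant_subspace (ops : seq 'End(V)) (U : {vspace V}) : Prop :=
  forall f, f \in ops -> (f @: U <= U)%VS.

Definition irreducible_rep (ops : seq 'End(V)) : Prop :=
  (fullv : {vspace V}) <> 0%VS /\
  forall U : {vspace V}, invariant_subspace ops U -> U = 0%VS \/ U = fullv.

End Subrepresentations.

(* Number of basis vectors of V_k when m13 - m23 = n, that is m12 - m22 + 1. *)
Definition dimV (n k : nat) : nat :=
  match k with
  | 0 => n.+1
  | 1 => n.+2
  | 2 => n
  | _ => n.+1
  end.

(* The symbol (m)_k with m11 = m22 + j is encoded by the pair of k and j. *)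
Definition symbol (n : nat) := {k : 'I_4 & 'I_(dimV n k)}.
Definition lev n (b : symbol n) : nat := nat_of_ord (tag b).
Definition pos n (b : symbol n) : nat := nat_of_ord (tagged b).

(* W = V_0 + V_1 + V_2 + V_3, as coordinate families on its basis of symbols *)
Definition W (R : realType) (n : nat) : vectType R[i] :=
  {ffun symbol n -> (R[i])^o}.

Section BasisExtension.
Variables (R : realType) (n : nat) (f : symbol n -> W R n).

Definition basis_ext_fun (w : W R n) : W R n := \sum_b (w b : R[i]) *: f b.

Fact basis_ext_is_linear : linear basis_ext_fun.
Proof.
move=> c u v; rewrite /basis_ext_fun scaler_sumr -big_split /=.
by apply: eq_bigr => b _; rewrite !ffunE scalerDl scalerA.
Qed.

HB.instance Definition _ :=
  GRing.isLinear.Build R[i] (W R n) (W R n) _ basis_ext_fun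
    basis_ext_is_linear.

(* the linear operator whose values on the basis are given by f *)
Definition basis_ext : 'End(W R n) := linfun basis_ext_fun.

Lemma basis_extE (b : symbol n) :
  basis_ext ([ffun c => (c == b)%:R] : W R n) = f b.
Proof.
rewrite lfunE /= /basis_ext_fun (bigD1 b) //= ffunE eqxx scale1r big1 ?addr0 //.
by move=> c /negPf cb; rewrite ffunE cb scale0r.
Qed.

End BasisExtension.

Section GelfandZetlin.
Variables (R : realType).
Local Notation C := R[i].
Variables (p q lp lq : C) (rt : nat -> C) (m13 m23 m33 a1 a2 a3 : C) (n : nat).

Local Notation "[ x ]q" := (qnum p q lp lq x) (at level 0, format "[ x ]q").

Definition pq_pow (x : C) : C := powC lp x * powC lq (- x).
Definition qp_pow (x : C) : C := powC lq x * powC lp (- x).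

(* [x]^(1/2), where rt k is the chosen square root of [k]; on basis symbols
   all arguments x occurring below are natural numbers (as m13 - m23 = n). *)
Definition sqrtq (x : C) : C := rt (Num.truncn (complex.Re x)).

Definition wl : C := (m13 - m23) / 2.
Definition l13 : C := m13 - 1.
Definition l23 : C := m23 - 2.
Definition l33 : C := m33 - 1.

Definition m12 (k : nat) : C :=
  match k with 0 | 1 => m13 | _ => m13 - 1 end.
Definition m22 (k : nat) : C :=
  match k with 0 | 2 => m23 | _ => m23 - 1 end.
Definition m31 (k : nat) : C :=
  match k with 0 => m33 | 1 | 2 => m33 + 1 | _ => m33 + 2 end.

Definition l12 (k : nat) : C := m12 k - 1.
Definition l22 (k : nat) : C := m22 k - 2.

Definition m11 (b : symbol n) : C := m22 (lev b) + (pos b)%:R.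
Definition l11 (b : symbol n) : C := m11 b - 1.

(* The vector (m)_k with given m11 = x, or 0 when this is not a basis symbol. *)
Definition gz (k : nat) (x : C) : W R n :=
  [ffun b => ((lev b == k) && (m11 b == x))%:R].

Definition E11 : 'End(W R n) := basis_ext (fun b =>
  (l11 b + 1) *: gz (lev b) (m11 b)).

Definition E22 : 'End(W R n) := basis_ext (fun b =>
  (l12 (lev b) + l22 (lev b) - l11 b + 2) *: gz (lev b) (m11 b)).

Definition E33 : 'End(W R n) := basis_ext (fun b =>
  m31 (lev b) *: gz (lev b) (m11 b)).

Definition Lop : 'End(W R n) := basis_ext (fun b =>
  ((l12 (lev b) - l22 (lev b) - 1) / 2) *: gz (lev b) (m11 b)).

Definition E12 : 'End(W R n) := basis_ext (fun b =>
  (sqrtq (l12 (lev b) - l11 b) * sqrtq (l11 b - l22 (lev b)))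
    *: gz (lev b) (m11 b + 1)).

Definition E21 : 'End(W R n) := basis_ext (fun b =>
  (sqrtq (l12 (lev b) - l11 b + 1) * sqrtq (l11 b - l22 (lev b) - 1))
    *: gz (lev b) (m11 b - 1)).

Definition E23 : 'End(W R n) := basis_ext (fun b =>
  match lev b with
  | 0 => 0
  | 1 => (a1 * pq_pow (l23 + l33 + 3)
            * (sqrtq (l11 b - l23) / sqrtq (2 * wl + 1))
            * [l23 + l33 + 3]q) *: gz 0 (m11 b)
  | 2 => (a2 * pq_pow (l23 + l33 + 4)
            * (sqrtq (l13 - l11 b) / sqrtq (2 * wl))
            * [l13 + l33 + 3]q) *: gz 0 (m11 b)
  | _ => (a3 * pq_pow (l13 + l23 + l33 - l11 b + 2)) *:
           ((1 / (a1 * q) * (sqrtq (l13 - l11 b) / sqrtq (2 * wl + 1))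
               * [l13 + l33 + 3]q) *: gz 1 (m11 b)
            - (1 / (a2 * p) * (sqrtq (l11 b - l23) * sqrtq (2 * wl))
               * ([l23 + l33 + 3]q / [2 * wl + 1]q)) *: gz 2 (m11 b))
  end).

Definition E32 : 'End(W R n) := basis_ext (fun b =>
  match lev b with
  | 0 => (1 / a1 * (sqrtq (l11 b - l23) / sqrtq (2 * wl + 1)))
           *: gz 1 (m11 b)
         + (1 / a2 * pq_pow (l13 - l11 b - 1)
              * (sqrtq (l13 - l11 b) * sqrtq (2 * wl) / [2 * wl + 1]q))
           *: gz 2 (m11 b)
  | 1 => (a1 / a3 * p * (sqrtq (l13 - l11 b) / sqrtq (2 * wl + 1)))
           *: gz 3 (m11 b)
  | 2 => (- (a2 / a3 * p * qp_pow (l13 - l11 b - 1)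
               * (sqrtq (l11 b - l23) / sqrtq (2 * wl))))
           *: gz 3 (m11 b)
  | _ => 0
  end).

Definition generators : seq 'End(W R n) :=
  [:: E11; E22; E33; Lop; E12; E21; E23; E32].

(* The encoded symbols of V_k are those with m12 - m11 and m11 - m22 natural. *)
Lemma m11P (n_def : m13 - m23 = n%:R) (k : 'I_4) (x : C) :
  (exists j : 'I_(dimV n k), x = m11 (Tagged (fun k : 'I_4 => 'I_(dimV n k)) j))
  <-> (exists a b : nat, m12 k - x = a%:R /\ x - m22 k = b%:R).
Proof.
have e13 : m13 = m23 + n%:R by rewrite -n_def addrC subrK.
have dimE : m12 k - m22 k + 1 = (dimV n k)%:R.
  rewrite /m12 /m22 e13; case: k => [[|[|[|[|//]]]] klt] /=; rewrite -?natr1; ring.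
split=> [[j ->]|[a [b [ea eb]]]].
  exists (dimV n k - j.+1)%N, (j : nat); rewrite /m11 /lev /pos /=; split; last ring.
  rewrite natrB // -dimE -natr1; ring.
have ed : (a + b).+1 = dimV n k.
  apply/eqP; rewrite -(eqr_nat R[i]) -dimE -natr1 natrD -ea -eb.
  by apply/eqP; ring.
have jlt : (b < dimV n k)%N by rewrite -ed ltnS leq_addl.
by exists (Ordinal jlt); rewrite /m11 /lev /pos /= -eb addrC subrK.
Qed.

End GelfandZetlin.

(* Main.v *)
Require Import Defs.
From mathcomp Require Import all_boot all_order all_algebra complex reals.
From mathcomp Require Import sequences exp trigo ring zify.

Set Implicit Arguments.
Unset Strict Implicit.
Unset Printing Implicit Defensive.

Import Order.TTheory GRing.Theory Num.Theory.
Local Open Scope ring_scope.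

(** The odd generators send a symbol to symbols of other levels with the same
    m11, the ladder operators move m11 inside one level, and all the remaining
    generators are diagonal in the basis of symbols. Two facts reduce the
    theorem to a question about which matrix entries vanish.

    - E33 and L take different joint values on V_0, V_1, V_2, V_3, and E11
      separates the symbols within one V_k. An invariant subspace therefore
      contains every component of each of its vectors ([component_mem]), hence
      is spanned by symbols, and it is closed under passing from a symbol b to a
      symbol c whenever some generator has a nonzero entry at (b, c)
      ([edge_mem]). So W is irreducible as soon as all symbols are connected in
      both directions ([separated_irreducible]).
    - Conversely a proper nonempty set of symbols that no entry leaves spans a
      proper invariant subspace ([closed_symbols_reducible]).

    Since pq is not a root of unity, [k] is nonzero for every natural k > 0
    ([qnum_nat_neq0]); so the ladder operators connect all symbols of one level,
    and E32 leads from V_0 to V_1 and V_2 and from V_1 to V_3. The way back is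
    given by E23, whose entries from V_1 to V_0 contain the factor
    B = [l23 + l33 + 3] and those from V_2 to V_0 and from V_3 to V_1 the factor
    A = [l13 + l33 + 3]. If both are nonzero, everything is connected
    ([all_levels_mem]). If B = 0, then V_1 + V_3 is invariant, because the
    entries of E23 from V_3 to V_2 contain B as well; if A = 0, then V_2 + V_3
    is ([reducible_B], [reducible_A]). *)

(** * The numbers [k] *)

Section ComplexPowers.
Variable R : realType.
Implicit Types x y lz : R[i].

Lemma expC_neq0 x : expC x != 0.
Proof.
rewrite eq_complex /= !mulf_eq0 gt_eqF ?expR_gt0 //=.
apply/negP => /andP[/eqP c0 /eqP s0].
have /eqP := cos2Dsin2 (complex.Im x).
by rewrite c0 s0 expr0n /= addr0 eq_sym oner_eq0.
Qed.

Lemma expCD x y : expC (x + y) = expC x * expC y.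
Proof.
case: x y => [a b] [c d]; rewrite /expC /= expRD cosD sinD; congr Complex; ring.
Qed.

Lemma expC0 : expC (0 : R[i]) = 1.
Proof. by rewrite /expC /= expR0 cos0 sin0 mulr1 mulr0. Qed.

Lemma powC_neq0 lz x : powC lz x != 0.
Proof. exact: expC_neq0. Qed.

Lemma powC_nat lz (k : nat) : powC lz k%:R = expC lz ^+ k.
Proof.
rewrite /powC; elim: k => [|k IHk]; first by rewrite mul0r expC0.
by rewrite -natr1 mulrDl mul1r expCD IHk exprSr.
Qed.

Lemma powCN lz x : powC lz (- x) = (powC lz x)^-1.
Proof.
apply: (mulIf (powC_neq0 lz x)); rewrite mulVf ?powC_neq0 //.
by rewrite /powC -expCD mulNr addNr expC0.
Qed.

(** [k] = p^-k ((pq)^k - 1) / (q - p^-1), so a zero with k > 0 would make pq a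
    root of unity. *)
Lemma qnum_nat_neq0 (p q lp lq : R[i]) (k : nat) :
    ~ is_root_of_unity (p * q) -> expC lp = p -> expC lq = q ->
  (0 < k)%N -> qnum p q lp lq k%:R != 0.
Proof.
move=> pq_generic lpE lqE k_gt0.
have powers_neq (j : nat) : (0 < j)%N -> q ^+ j - (p ^+ j)^-1 != 0.
  move=> j_gt0; rewrite subr_eq0; apply/eqP => qpj; apply: pq_generic.
  exists j => //; apply/unity_rootP.
  by rewrite exprMn qpj divff // expf_neq0 // -lpE expC_neq0.
rewrite /qnum mulf_neq0 ?invr_eq0 ?powCN ?powC_nat ?lpE ?lqE ?powers_neq //.
by have := powers_neq 1%N isT; rewrite !expr1.
Qed.

Lemma sqrtq_nat (rt : nat -> R[i]) (k : nat) : sqrtq rt k%:R = rt k.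
Proof.
rewrite /sqrtq.
have -> : complex.Re (k%:R : R[i]) = k%:R by rewrite raddfMn.
by rewrite natrK.
Qed.

End ComplexPowers.

(** * Operators on a space with a basis of symbols *)

Section Coordinates.
Variables (R : realType) (n : nat).
Implicit Types (b c : symbol n) (v w : W R n) (f : 'End(W R n)) (U : {vspace W R n}).

Definition bvec b : W R n := [ffun c => (c == b)%:R].

Lemma bvecE b c : bvec b c = (c == b)%:R.
Proof. by rewrite ffunE. Qed.

Lemma scaleWE (a : R[i]) w c : (a *: w) c = a * (w c : R[i]).
Proof. by rewrite ffunE. Qed.

Lemma addWE v w c : (v + w) c = (v c : R[i]) + (w c : R[i]).
Proof. by rewrite ffunE. Qed.

Lemma subWE v w c : (v - w) c = (v c : R[i]) - (w c : R[i]).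
Proof. by rewrite addWE; congr (_ + _); rewrite ffunE. Qed.

Lemma sum_bvec w : w = \sum_b (w b : R[i]) *: bvec b.
Proof.
have termE b c : ((w b : R[i]) *: bvec b) c = (w b : R[i]) * (c == b)%:R.
  by rewrite scaleWE bvecE.
apply/ffunP => c; rewrite sum_ffunE (eq_bigr _ (fun b _ => termE b c)).
rewrite (bigD1 c) //= eqxx mulr1 big1 ?addr0 // => b /negPf bc.
by rewrite eq_sym bc mulr0.
Qed.

Lemma op_coord f w c : f w c = \sum_b (w b : R[i]) * (f (bvec b) c : R[i]).
Proof.
rewrite {1}(sum_bvec w) raddf_sum sum_ffunE /=; apply: eq_bigr => b _.
by rewrite linearZ scaleWE.
Qed.

Lemma bvec_full U : (forall b, bvec b \in U) -> U = fullv.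
Proof.
move=> bU; apply/eqP; rewrite eqEsubv subvf /=; apply/subvP => w _.
by rewrite (sum_bvec w) memv_suml // => b _; rewrite memvZ.
Qed.

(** The span of the basis vectors with symbols in S, obtained as the kernel of
    the projection to the other coordinates so that membership is a vanishing
    condition. *)
Definition coord_space (S : pred (symbol n)) : {vspace W R n} :=
  lker (basis_ext (fun b => if S b then 0 else bvec b)).

Lemma mem_coord_space S w :
  reflect (forall c, ~~ S c -> w c = 0) (w \in coord_space S).
Proof.
have projE c : basis_ext (fun b => if S b then 0 else bvec b) w c
             = (if S c then 0 else w c).
  rewrite op_coord (bigD1 c) //= basis_extE big1 ?addr0 => [|b /negPf bc].
    by case: ifP; rewrite ?bvecE ?ffunE ?eqxx ?mulr0 ?mulr1.
  by rewrite basis_extE; case: ifP; rewrite ?bvecE ?ffunE ?mulr0 // eq_sym bc mulr0.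
rewrite memv_ker; apply: (iffP eqP) => [w0 c /negPf Sc | w0].
  by have := projE c; rewrite w0 Sc ffunE.
by apply/ffunP => c; rewrite projE ffunE; case: ifPn => // /w0.
Qed.

Lemma coord_space_invariant (ops : seq 'End(W R n)) (S : pred (symbol n)) :
    (forall f b c, f \in ops -> S b -> ~~ S c -> f (bvec b) c = 0) ->
  invariant_subspace ops (coord_space S).
Proof.
move=> opsS f f_ops; apply/subvP => _ /memv_imgP[w /mem_coord_space wS ->].
apply/mem_coord_space => c Sc; rewrite op_coord big1 // => b _.
by have [Sb|/wS ->] := boolP (S b); rewrite ?(opsS _ _ _ f_ops Sb Sc) ?mulr0 ?mul0r.
Qed.

Lemma closed_symbols_reducible (ops : seq 'End(W R n)) (S : pred (symbol n)) b0 c0 :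
    S b0 -> ~~ S c0 ->
    (forall f b c, f \in ops -> S b -> ~~ S c -> f (bvec b) c = 0) ->
  ~ irreducible_rep ops.
Proof.
move=> Sb0 Sc0 /coord_space_invariant invS [_ /(_ _ invS)[] US].
  have : bvec b0 \in coord_space S.
    apply/mem_coord_space => c Sc; rewrite bvecE; case: eqP Sc => // ->.
    by rewrite Sb0.
  rewrite US memv0 => /eqP/ffunP/(_ b0)/eqP.
  by rewrite bvecE ffunE eqxx oner_eq0.
have : bvec c0 \in coord_space S by rewrite US memvf.
move/mem_coord_space/(_ c0 Sc0)/eqP.
by rewrite bvecE eqxx oner_eq0.
Qed.

Definition separating_diagonals (ops : seq 'End(W R n)) :=
  forall b c, b != c ->
  exists2 f, f \in ops &
  exists2 lam : symbol n -> R[i],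
    (forall d, f (bvec d) = lam d *: bvec d) & lam b != lam c.

Section Separated.
Variable ops : seq 'End(W R n).
Hypothesis ops_sep : separating_diagonals ops.

(** If f is diagonal with eigenvalues lam, then f - lam c kills the coordinate
    at c, and after division by lam b - lam c it keeps the one at b. Doing this
    for all c other than b leaves only the component at b. *)
Lemma component_mem U w b : invariant_subspace ops U -> w \in U ->
  (w b : R[i]) != 0 -> bvec b \in U.
Proof.
move=> invU wU wb0.
have [v [vU vb v0]] : exists v : W R n, [/\ v \in U, v b = w b &
    forall c, c \in [seq d <- enum {: symbol n} | d != b] -> v c = 0].
  have : b \notin [seq d <- enum {: symbol n} | d != b].
    by rewrite mem_filter eqxx.
  elim: [seq d <- _ | _] => [|c s IHs]; first by exists w.
  rewrite in_cons negb_or => /andP[bc /IHs[v [vU vb v0]]].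
  have [f f_ops [lam f_diag lam_bc]] := ops_sep bc.
  have fE d : f v d = lam d * (v d : R[i]).
    rewrite op_coord (bigD1 d) //= big1 ?addr0 => [|a /negPf ad].
      by rewrite f_diag scaleWE bvecE eqxx mulr1 mulrC.
    by rewrite f_diag scaleWE bvecE eq_sym ad !mulr0.
  exists ((lam b - lam c)^-1 *: (f v - lam c *: v)).
  have vE d : ((lam b - lam c)^-1 *: (f v - lam c *: v)) d
            = (lam b - lam c)^-1 * ((lam d - lam c) * (v d : R[i])).
    by rewrite scaleWE subWE fE scaleWE mulrBl.
  split.
  - rewrite memvZ // rpredB ?memvZ //.
    by apply: (subvP (invU _ f_ops)); apply: memv_img.
  - by rewrite vE mulrA mulVf ?mul1r ?subr_eq0.
  - move=> d; rewrite in_cons vE => /orP[/eqP -> | /v0 ->]; last by rewrite !mulr0.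
    by rewrite subrr mul0r mulr0.
have -> : bvec b = (w b : R[i])^-1 *: v.
  apply/ffunP => c; rewrite bvecE scaleWE.
  have [-> | cb] := eqVneq c b; first by rewrite vb mulVf.
  by rewrite v0 ?mulr0 // mem_filter cb mem_enum.
by rewrite memvZ.
Qed.

Lemma edge_mem U f b c : invariant_subspace ops U -> f \in ops ->
  f (bvec b) c != 0 -> bvec b \in U -> bvec c \in U.
Proof.
move=> invU f_ops fbc bU; apply: (component_mem (w := f (bvec b))) => //.
by apply: (subvP (invU _ f_ops)); apply: memv_img.
Qed.

Lemma separated_irreducible b0 :
    (forall U, invariant_subspace ops U ->
       forall b c, bvec b \in U -> bvec c \in U) ->
  irreducible_rep ops.
Proof.
move=> connected; split.
  move=> full0; have : bvec b0 \in (fullv : {vspace W R n}) by rewrite memvf.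
  rewrite full0 memv0 => /eqP/ffunP/(_ b0)/eqP.
  by rewrite bvecE ffunE eqxx oner_eq0.
move=> U invU; have [-> | U0] := eqVneq U 0%VS; [by left | right].
have w0 : vpick U != 0 by rewrite vpick0.
have [b wb] : exists b, (vpick U b : R[i]) != 0.
  apply/existsP; apply: contra_neqT w0; rewrite negb_exists => /forallP w0.
  by apply/ffunP => b; rewrite ffunE; apply/eqP; rewrite -[_ == _]negbK.
apply: bvec_full => c; apply: (connected U invU b).
exact: component_mem (memv_pick U) wb.
Qed.

End Separated.
End Coordinates.

(** * The Gelfand-Zetlin basis *)

Section Symbols.
Variable n : nat.
Implicit Types b c : symbol n.

Lemma symbol_inj b c : lev b = lev c -> pos b = pos c -> b = c.
Proof.
case: b c => [k i] [k' j] /val_inj/= kk'; case: k' / kk' j => j.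
by move=> /val_inj/= ->.
Qed.

Lemma lev_lt4 b : (lev b < 4)%N.
Proof. exact: ltn_ord. Qed.

Lemma pos_lt b : (pos b < dimV n (lev b))%N.
Proof. exact: ltn_ord. Qed.

Lemma symbol_exists (k j : nat) : (k < 4)%N -> (j < dimV n k)%N ->
  exists b, lev b = k /\ pos b = j.
Proof.
move=> k4 jd.
by exists (Tagged (fun k : 'I_4 => 'I_(dimV n k)) (Ordinal jd : 'I_(dimV n (Ordinal k4)))).
Qed.

End Symbols.

Section Typicality.
Variables (R : realType) (p q lp lq : R[i]) (rt : nat -> R[i]).
Variables (m13 m23 m33 a1 a2 a3 : R[i]) (n : nat).
Hypotheses (p_neq0 : p != 0) (q_neq0 : q != 0).
Hypothesis pq_generic : ~ is_root_of_unity (p * q).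
Hypotheses (lp_log : expC lp = p) (lq_log : expC lq = q).
Hypothesis rt_sqrt : forall k : nat, rt k ^+ 2 = qnum p q lp lq k%:R.
Hypothesis n_def : m13 - m23 = n%:R.
Hypotheses (a1_neq0 : a1 != 0) (a2_neq0 : a2 != 0) (a3_neq0 : a3 != 0).

Implicit Types (b c : symbol n) (U : {vspace W R n}).

Local Notation gens := (generators p q lp lq rt m13 m23 m33 a1 a2 a3 n).
Local Notation gen_E11 := (E11 m23 n).
Local Notation gen_E33 := (E33 m23 m33 n).
Local Notation gen_L := (Lop m13 m23 n).
Local Notation gen_E12 := (E12 rt m13 m23 n).
Local Notation gen_E21 := (E21 rt m13 m23 n).
Local Notation gen_E23 := (E23 p q lp lq rt m13 m23 m33 a1 a2 a3 n).
Local Notation gen_E32 := (E32 p q lp lq rt m13 m23 a1 a2 a3 n).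
Local Notation bracketA := (qnum p q lp lq (l13 m13 + l33 m33 + 3)).
Local Notation bracketB := (qnum p q lp lq (l23 m23 + l33 m33 + 3)).

Lemma m13E : m13 = m23 + n%:R.
Proof. by rewrite -n_def addrC subrK. Qed.

Lemma rt_neq0 k : (0 < k)%N -> rt k != 0.
Proof.
move=> k0; rewrite -sqrf_eq0 rt_sqrt.
exact: qnum_nat_neq0 pq_generic lp_log lq_log k0.
Qed.

Lemma two_wl : 2 * wl m13 m23 = n%:R.
Proof. by rewrite /wl n_def mulrC divfK // pnatr_eq0. Qed.

Lemma gz_m11 b : gz m23 n (lev b) (m11 m23 b) = bvec R b.
Proof.
apply/ffunP => c; rewrite !ffunE; congr (nat_of_bool _)%:R.
apply/andP/eqP => [[/eqP lcb]|-> //].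
rewrite /m11 lcb (inj_eq (addrI _)) eqr_nat => /eqP.
exact: symbol_inj.
Qed.

Lemma gz_eq1 k x c : lev c = k -> m11 m23 c = x -> gz m23 n k x c = 1.
Proof. by move=> <- <-; rewrite ffunE !eqxx. Qed.

Lemma gz_eq0 k x c : lev c <> k -> gz m23 n k x c = 0.
Proof. by move=> /eqP/negPf ck; rewrite ffunE ck. Qed.

Lemma mem_generators i : (i < 8)%N -> nth 0 gens i \in gens.
Proof. by move=> i8; apply: (@mem_nth _ 0 gens i i8). Qed.

(** E33 and L tell the four levels apart, and E11 the symbols in one level. *)
Lemma generators_separating : separating_diagonals gens.
Proof.
move=> b c bc; have [lbc|lbc] := eqVneq (lev b) (lev c).
  exists gen_E11; first exact: (mem_generators (isT : 0 < 8)%N).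
  exists (fun d => l11 m23 d + 1) => [d|]; first by rewrite basis_extE gz_m11.
  rewrite (inj_eq (addIr _)) /l11 (inj_eq (addIr _)) /m11 lbc.
  rewrite (inj_eq (addrI _)) eqr_nat; apply: contraNneq bc => pbc.
  exact/eqP/symbol_inj.
have [m31bc|m31bc] := eqVneq (m31 m33 (lev b)) (m31 m33 (lev c)); last first.
  exists gen_E33; first exact: (mem_generators (isT : 2 < 8)%N).
  by exists (fun d => m31 m33 (lev d)) => // d; rewrite basis_extE gz_m11.
exists gen_L; first exact: (mem_generators (isT : 3 < 8)%N).
exists (fun d => (l12 m13 (lev d) - l22 m23 (lev d) - 1) / 2) => [d|].
  by rewrite basis_extE gz_m11.
(* m31 - m33 is 0, 1, 1, 2 on the four levels, so only V_1 and V_2 remain, and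
   there the weight of L differs by 1. *)
have level12 k j : (k < 4)%N -> (j < 4)%N -> k != j -> m31 m33 k = m31 m33 j ->
  (k == 1%N) && (j == 2) || (k == 2) && (j == 1%N).
  have m31E i : (i < 4)%N -> m31 m33 i = m33 + (nth 0 [:: 0; 1; 1; 2] i)%:R.
    by case: i => [|[|[|[|]]]] //= _; rewrite addr0.
  move=> k4 j4 kj; rewrite !m31E // => /addrI/eqP; rewrite eqr_nat.
  by case: k k4 kj => [|[|[|[|]]]] // _; case: j j4 => [|[|[|[|]]]].
rewrite (inj_eq (mulIf _)) ?invr_eq0 ?pnatr_eq0 //.
rewrite (inj_eq (addIr _)) -subr_eq0.
case/orP: (level12 _ _ (lev_lt4 b) (lev_lt4 c) lbc m31bc) => /andP[/eqP -> /eqP ->].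
  rewrite (_ : _ - _ = 2) ?pnatr_eq0 // /l12 /l22 /=; ring.
rewrite (_ : _ - _ = - 2) ?oppr_eq0 ?pnatr_eq0 // /l12 /l22 /=; ring.
Qed.

(** * Matrix entries of the generators *)

(** The coordinate l11 - l23 shared by the symbols of all levels: the odd
    generators preserve it. It runs over 1..n+1, 0..n+1, 1..n and 0..n in V_0,
    V_1, V_2 and V_3. *)
Definition height b : nat := pos b + ~~ odd (lev b).

Lemma height_bounds b :
  (~~ odd (lev b) <= height b)%N && (height b <= n + (lev b < 2))%N.
Proof.
rewrite /height; have := pos_lt b; have := lev_lt4 b.
by case: (lev b) => [|[|[|[|k]]]] //= _ ?; lia.
Qed.

Lemma m11_height b : m11 m23 b = m23 - 1 + (height b)%:R.
Proof.
rewrite /m11 /height natrD; move: (lev_lt4 b).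
by case: (lev b) => [|[|[|[|k]]]] //= _; ring.
Qed.

Lemma eq_m11 b c : height b = height c -> m11 m23 b = m11 m23 c.
Proof. by rewrite !m11_height => ->. Qed.

Lemma low_gap b : l11 m23 b - l23 m23 = (height b)%:R.
Proof. by rewrite /l11 /l23 m11_height; ring. Qed.

Lemma high_gap b : l13 m13 - l11 m23 b = (n.+1 - height b)%:R.
Proof.
have /andP[_ hb] := height_bounds b.
rewrite natrB; last by move: hb; case: (_ < 2)%N => /= ?; lia.
by rewrite /l13 /l11 m11_height m13E -natr1; ring.
Qed.

Lemma bottom_gap b : l11 m23 b - l22 m23 (lev b) = (pos b).+1%:R.
Proof. by rewrite /l11 /l22 /m11 -natr1; ring. Qed.

Lemma top_gap b :
  l12 m13 (lev b) - l11 m23 b = (dimV n (lev b) - (pos b).+1)%:R.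
Proof.
rewrite natrB ?pos_lt // /l12 /l11 /m11 m13E.
by move: (lev_lt4 b); case: (lev b) => [|[|[|[|k]]]] //= _; rewrite -?natr1; ring.
Qed.

Lemma E12_entry b c : lev c = lev b -> pos c = (pos b).+1 ->
  gen_E12 (bvec R b) c != 0.
Proof.
move=> lcb pcb; rewrite basis_extE scaleWE gz_eq1 ?mulr1 //; last first.
  by rewrite /m11 lcb pcb -natr1 addrA.
rewrite top_gap bottom_gap !sqrtq_nat mulf_neq0 ?rt_neq0 // subn_gt0.
by rewrite -pcb -lcb pos_lt.
Qed.

Lemma E21_entry b c : lev c = lev b -> pos b = (pos c).+1 ->
  gen_E21 (bvec R b) c != 0.
Proof.
move=> lcb pbc; rewrite basis_extE scaleWE gz_eq1 ?mulr1 //; last first.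
  by rewrite /m11 lcb pbc -natr1; ring.
rewrite top_gap natr1 bottom_gap -(natr1 (pos b)) addrK !sqrtq_nat.
by rewrite mulf_neq0 ?rt_neq0 // pbc.
Qed.

Lemma wl_gap : 2 * wl m13 m23 + 1 = n.+1%:R.
Proof. by rewrite two_wl natr1. Qed.

Lemma E32_entry01 b c : lev b = 0%N -> lev c = 1%N -> height b = height c ->
  gen_E32 (bvec R b) c != 0.
Proof.
move=> lb lc hbc; have := height_bounds b; rewrite lb => /andP[/= h0 _].
rewrite basis_extE lb addWE !scaleWE gz_eq1 ?(eq_m11 hbc) //.
rewrite gz_eq0 ?lc // mulr0 addr0 mulr1 wl_gap low_gap !sqrtq_nat.
by rewrite !mulf_neq0 ?invr_eq0 ?oner_eq0 ?rt_neq0.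
Qed.

Lemma E32_entry02 b c : lev b = 0%N -> lev c = 2 -> height b = height c ->
  gen_E32 (bvec R b) c != 0.
Proof.
move=> lb lc hbc; have := height_bounds c.
rewrite lc -hbc addn0 => /andP[/= h0 hn].
rewrite basis_extE lb addWE !scaleWE (gz_eq1 lc) ?(eq_m11 hbc) //.
rewrite gz_eq0 ?lc // mulr0 add0r mulr1 wl_gap two_wl high_gap !sqrtq_nat.
rewrite !mulf_neq0 ?invr_eq0 ?oner_eq0 ?powC_neq0 ?rt_neq0 //.
- by rewrite subn_gt0 ltnS.
- exact: leq_trans hn.
- exact: qnum_nat_neq0 pq_generic lp_log lq_log _.
Qed.

Lemma E32_entry13 b c : lev b = 1%N -> lev c = 3 -> height b = height c ->
  gen_E32 (bvec R b) c != 0.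
Proof.
move=> lb lc hbc; have := height_bounds c.
rewrite lc -hbc addn0 => /andP[_ hn].
rewrite basis_extE lb scaleWE gz_eq1 ?(eq_m11 hbc) //.
rewrite mulr1 wl_gap high_gap !sqrtq_nat.
by rewrite !mulf_neq0 ?invr_eq0 ?rt_neq0 // subn_gt0 ltnS.
Qed.

Lemma E23_entry10 b c : bracketB != 0 ->
  lev b = 1%N -> lev c = 0%N -> height b = height c ->
  gen_E23 (bvec R b) c != 0.
Proof.
move=> B0 lb lc hbc; have := height_bounds c.
rewrite lc -hbc => /andP[/= h0 _].
rewrite basis_extE lb scaleWE gz_eq1 ?(eq_m11 hbc) // mulr1 wl_gap low_gap.
move: bracketB B0 => B B0.
by rewrite !sqrtq_nat !mulf_neq0 ?invr_eq0 ?powC_neq0 ?rt_neq0.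
Qed.

Lemma E23_entry20 b c : bracketA != 0 ->
  lev b = 2 -> lev c = 0%N -> height b = height c ->
  gen_E23 (bvec R b) c != 0.
Proof.
move=> A0 lb lc hbc; have := height_bounds b.
rewrite lb addn0 => /andP[/= h0 hn].
rewrite basis_extE lb scaleWE gz_eq1 ?(eq_m11 hbc) // mulr1 two_wl high_gap.
move: bracketA A0 => A A0.
rewrite !sqrtq_nat !mulf_neq0 ?invr_eq0 ?powC_neq0 ?rt_neq0 //.
  by rewrite subn_gt0 ltnS.
exact: leq_trans hn.
Qed.

Lemma E23_entry31 b c : bracketA != 0 ->
  lev b = 3 -> lev c = 1%N -> height b = height c ->
  gen_E23 (bvec R b) c != 0.
Proof.
move=> A0 lb lc hbc; have := height_bounds b.
rewrite lb addn0 => /andP[_ hn].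
rewrite basis_extE lb scaleWE subWE !scaleWE.
rewrite gz_eq1 ?(eq_m11 hbc) // gz_eq0 ?lc // mulr0 oppr0 addr0 mulr1.
rewrite wl_gap high_gap !sqrtq_nat; move: bracketA A0 => A A0.
by rewrite !mulf_neq0 ?invr_eq0 ?oner_eq0 ?mulf_neq0 ?powC_neq0 ?rt_neq0
           // subn_gt0 ltnS.
Qed.

(** * Connectedness of the symbols *)

Section Connected.
Variable U : {vspace W R n}.
Hypothesis invU : invariant_subspace gens U.

Lemma E12_mem b c : lev c = lev b -> pos c = (pos b).+1 ->
  bvec R b \in U -> bvec R c \in U.
Proof.
move=> lcb pcb; apply: (edge_mem generators_separating invU) (E12_entry lcb pcb).
exact: (mem_generators (isT : 4 < 8)%N).
Qed.

Lemma E21_mem b c : lev c = lev b -> pos b = (pos c).+1 ->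
  bvec R b \in U -> bvec R c \in U.
Proof.
move=> lcb pbc; apply: (edge_mem generators_separating invU) (E21_entry lcb pbc).
exact: (mem_generators (isT : 5 < 8)%N).
Qed.

Lemma E23_mem b c : gen_E23 (bvec R b) c != 0 ->
  bvec R b \in U -> bvec R c \in U.
Proof.
apply: (edge_mem generators_separating invU).
exact: (mem_generators (isT : 6 < 8)%N).
Qed.

Lemma E32_mem b c : gen_E32 (bvec R b) c != 0 ->
  bvec R b \in U -> bvec R c \in U.
Proof.
apply: (edge_mem generators_separating invU).
exact: (mem_generators (isT : 7 < 8)%N).
Qed.

(** The ladder operators connect any symbol with the one of its level that has
    the lowest m11. *)
Lemma level_mem b c : lev c = lev b -> bvec R b \in U -> bvec R c \in U.
Proof.
have ladder j d0 d : lev d = lev d0 -> pos d0 = 0%N -> pos d = j ->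
    (bvec R d0 \in U) = (bvec R d \in U).
  elim: j d => [|j IHj] d ld pd0 pd.
    by congr (bvec R _ \in U); apply: symbol_inj; rewrite ?pd.
  have [|d' [ld' pd']] := @symbol_exists n (lev d) j (lev_lt4 d).
    by rewrite ltnW // -pd pos_lt.
  rewrite (IHj d') ?ld' //; apply/idP/idP; first by apply: E12_mem; rewrite ?pd'.
  by apply: E21_mem; rewrite ?pd'.
move=> lcb; have [|d [ld pd]] := @symbol_exists n (lev b) 0 (lev_lt4 b).
  exact: leq_ltn_trans (pos_lt b).
by rewrite -(@ladder (pos b) d b) ?ld // (@ladder (pos c) d c) ?ld.
Qed.

Lemma level_eq_mem b c : lev c = lev b -> (bvec R b \in U) = (bvec R c \in U).
Proof. by move=> lcb; apply/idP/idP; apply: level_mem. Qed.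

Hypotheses (A_neq0 : bracketA != 0) (B_neq0 : bracketB != 0).

(** Every level is joined with V_0 in both directions: V_1 and V_2 by a single
    odd step, V_3 through V_1. The representatives of V_0, V_1, V_2 have height
    1, and the step between V_1 and V_3 is taken at height 0. *)
Lemma all_levels_mem b c : bvec R b \in U -> bvec R c \in U.
Proof.
have [//|d0 [l0 p0]] := @symbol_exists n 0 0 isT.
have [//|d1 [l1 p1]] := @symbol_exists n 1 1 isT.
have [//|e1 [k1 r1]] := @symbol_exists n 1 0 isT.
have [//|d3 [l3 p3]] := @symbol_exists n 3 0 isT.
have h01 : height d0 = height d1 by rewrite /height l0 l1 p0 p1.
have h13 : height e1 = height d3 by rewrite /height k1 l3 r1 p3.
have e1d1 : (bvec R e1 \in U) = (bvec R d1 \in U) by apply: level_eq_mem; rewrite k1.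
have mem1 : (bvec R d0 \in U) = (bvec R d1 \in U).
  apply/idP/idP; first exact: E32_mem (E32_entry01 l0 l1 h01).
  exact: E23_mem (E23_entry10 B_neq0 l1 l0 (esym h01)).
have mem3 : (bvec R d0 \in U) = (bvec R d3 \in U).
  rewrite mem1 -e1d1; apply/idP/idP; first exact: E32_mem (E32_entry13 k1 l3 h13).
  exact: E23_mem (E23_entry31 A_neq0 l3 k1 (esym h13)).
have mem d : (bvec R d0 \in U) = (bvec R d \in U).
  move: (lev_lt4 d); case ld: (lev d) => [|[|[|[|k]]]] // _.
  - by apply: level_eq_mem; rewrite ld l0.
  - by rewrite mem1; apply: level_eq_mem; rewrite ld l1.
  (* V_2 is zero for n = 0; here d shows that it is not. *)
  - have [||d2 [l2 p2]] := @symbol_exists n 2 0; rewrite //.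
      by have := pos_lt d; rewrite ld; apply: leq_ltn_trans.
    have h02 : height d0 = height d2 by rewrite /height l0 l2 p0 p2.
    rewrite (@level_eq_mem d d2) ?ld //; apply/idP/idP.
      exact: E32_mem (E32_entry02 l0 l2 h02).
    exact: E23_mem (E23_entry20 A_neq0 l2 l0 (esym h02)).
  - by rewrite mem3; apply: level_eq_mem; rewrite ld l3.
by rewrite -!mem.
Qed.

End Connected.

Lemma typical_irreducible : bracketA != 0 -> bracketB != 0 ->
  irreducible_rep gens.
Proof.
move=> A0 B0; have [//|b0 _] := @symbol_exists n 0 0 isT.
apply: (separated_irreducible generators_separating b0) => U invU b c.
exact: all_levels_mem.
Qed.

(** * Closed sets of symbols *)

(** The even generators preserve each V_k, so only the entries of E23 and E32
    that leave the levels in K are to be checked. *)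
Lemma odd_closed_reducible (K : pred nat) (k j : nat) :
    (k < 4)%N -> (0 < dimV n k)%N -> K k ->
    (j < 4)%N -> (0 < dimV n j)%N -> ~~ K j ->
    (forall b c, K (lev b) -> ~~ K (lev c) ->
       gen_E23 (bvec R b) c = 0 /\ gen_E32 (bvec R b) c = 0) ->
  ~ irreducible_rep gens.
Proof.
move=> k4 dk Kk j4 dj Kj oddK.
have [b0 [lb0 _]] := symbol_exists k4 dk.
have [c0 [lc0 _]] := symbol_exists j4 dj.
apply: (@closed_symbols_reducible _ _ _ (fun b => K (lev b)) b0 c0).
- by rewrite lb0.
- by rewrite lc0.
move=> f b c f_gens Kb Kc; have lcb : lev c <> lev b by move=> lcb; rewrite lcb Kb in Kc.
have [E23bc E32bc] := oddK b c Kb Kc.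
have even_entry (lam x : symbol n -> R[i]) :
    basis_ext (fun d => lam d *: gz m23 n (lev d) (x d)) (bvec R b) c = 0.
  by rewrite basis_extE scaleWE gz_eq0 ?mulr0.
suff /allP/(_ f f_gens)/eqP :
  all (fun g : 'End(W R n) => g (bvec R b) c == 0) gens by [].
do 6![apply/andP; split; first exact/eqP/even_entry].
apply/andP; split; first by apply/eqP; exact: E23bc.
by rewrite andbT; apply/eqP; exact: E32bc.
Qed.

(** V_1 + V_3 is invariant: [l23 + l33 + 3] is a factor of the entries of E23
    from V_1 to V_0 and of those from V_3 to V_2. *)
Lemma reducible_B : bracketB = 0 -> ~ irreducible_rep gens.
Proof.
move=> B0; apply: (@odd_closed_reducible odd 1 0) => // b c Kb Kc.
have lcK k : odd k -> lev c <> k by move=> kK lc; rewrite lc kK in Kc.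
have /orP[/eqP lb | /eqP lb] : (lev b == 1%N) || (lev b == 3).
- by move: (lev_lt4 b) Kb; case: (lev b) => [|[|[|[|]]]].
- split; rewrite basis_extE lb; first by rewrite B0 mulr0 scale0r ffunE.
  by rewrite scaleWE gz_eq0 ?mulr0 //; apply: lcK.
split; rewrite basis_extE lb; last by rewrite ffunE.
rewrite scaleWE subWE !scaleWE gz_eq0; last exact: lcK.
by rewrite B0 mul0r !mulr0 mul0r subrr mulr0.
Qed.

(** V_2 + V_3 is invariant: [l13 + l33 + 3] is a factor of the entries of E23
    from V_2 to V_0 and of those from V_3 to V_1. *)
Lemma reducible_A : bracketA = 0 -> ~ irreducible_rep gens.
Proof.
move=> A0; apply: (@odd_closed_reducible (leq 2) 3 0) => // b c Kb Kc.
have lcK k : (2 <= k)%N -> lev c <> k by move=> kK lc; rewrite lc kK in Kc.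
have /orP[/eqP lb | /eqP lb] : (lev b == 2) || (lev b == 3).
- by move: (lev_lt4 b) Kb; case: (lev b) => [|[|[|[|]]]].
- split; rewrite basis_extE lb; first by rewrite A0 mulr0 scale0r ffunE.
  by rewrite scaleWE gz_eq0 ?mulr0 //; apply: lcK.
split; rewrite basis_extE lb; last by rewrite ffunE.
rewrite scaleWE subWE !scaleWE (@gz_eq0 2); last exact: lcK.
by rewrite A0 mulr0 mul0r mulr0 subrr mulr0.
Qed.

End Typicality.

Theorem proposition4 (R : realType) (p q lp lq : R[i]) (rt : nat -> R[i])
    (m13 m23 m33 a1 a2 a3 : R[i]) (n : nat)
    (p_neq0 : p != 0) (q_neq0 : q != 0)
    (p_generic : ~ is_root_of_unity p) (q_generic : ~ is_root_of_unity q)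
    (pq_generic : ~ is_root_of_unity (p * q))
    (lp_log : expC lp = p) (lq_log : expC lq = q)
    (rt_sqrt : forall k : nat, rt k ^+ 2 = qnum p q lp lq k%:R)
    (n_def : m13 - m23 = n%:R)
    (a1_neq0 : a1 != 0) (a2_neq0 : a2 != 0) (a3_neq0 : a3 != 0) :
  irreducible_rep (generators p q lp lq rt m13 m23 m33 a1 a2 a3 n) <->
  qnum p q lp lq (l13 m13 + l33 m33 + 3)
    * qnum p q lp lq (l23 m23 + l33 m33 + 3) != 0.
Proof.
have typical := @typical_irreducible R p q lp lq rt m13 m23 m33 a1 a2 a3 n
  p_neq0 q_neq0 pq_generic lp_log lq_log rt_sqrt n_def a1_neq0 a2_neq0 a3_neq0.
have redA := @reducible_A R p q lp lq rt m13 m23 m33 a1 a2 a3 n.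
have redB := @reducible_B R p q lp lq rt m13 m23 m33 a1 a2 a3 n.
move: typical redA redB.
move: (qnum p q lp lq (l13 _ + _ + _)) (qnum p q lp lq (l23 _ + _ + _)) => A B.
move=> typical redA redB; split=> [irr | ]; last first.
  by rewrite mulf_eq0 negb_or => /andP[A0 B0]; exact: typical.
apply: mulf_neq0; apply/eqP; [move/redA | move/redB]; exact.
Qed.
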